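(* Let $k,\ell,m\ge 1$ be integers, let $b\in\mathbb{R}[y]$ be a real polynomial in $y\in\mathbb{R}^\ell$, and let $P:\mathbb{R}^k\times\mathbb{R}^\ell\to\mathcal{S}^m$ be a polynomial matrix, i.e. a symmetric $m\times m$ matrix whose entries are real polynomials in $(x,y)$. Let $q_1,\dots,q_m$ be the real polynomials in $(x,y)$ determined by $$\det\bigl(t\,I_m-P(x,y)\bigr)=t^m+\sum_{j=1}^m(-1)^j q_j(x,y)\,t^{m-j}.$$ Then for every real $\lambda>0$ the function $$\widetilde{\mathcal{L}}_\lambda:\mathbb{R}^k\times\mathbb{R}^\ell\to\mathbb{R},\qquad \widetilde{\mathcal{L}}_\lambda(x,y)=b(y)-\lambda\prod_{j=1}^m q_j(x,y),$$ is definable in a tame structure.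
   Context: $\mathcal{S}^m$ is the space of real symmetric $m\times m$ matrices and $I_m$ is the identity matrix. The data $b,P$ define the polynomial matrix inequality (PMI) problem $\inf b(y)$ subject to $P(x,y)\succeq 0$, where $\succeq 0$ means positive semidefinite. An $\mathbb{R}$-structure $S$ is a collection $\{S^p\}_{p\ge1}$, where each $S^p$ is a set of subsets of $\mathbb{R}^p$, such that: (A1) $S^p$ contains the zero sets of all finite collections of real polynomials in $p$ variables; (A2) for every linear map $L:\mathbb{R}^p\to\mathbb{R}$, the set $\{x\in\mathbb{R}^p: L(x)\ge0\}$ belongs to $S^p$; (P1) each $S^p$ is closed under (finite) unions, intersections and complements; (P2) if $X\in S^p$ and $Y\in S^q$ then $X\times Y\in S^{p+q}$; (P3) if $T:\mathbb{R}^p\to\mathbb{R}^q$ is affine and $X\in S^p$ then $T(X)\in S^q$. An $\mathbb{R}$-structure $S$ is a tame structure (o-minimal structure) if every $X\in S^1$ is a finite union of singletons and open intervals $(a,b)$ with $-\infty\le a<b\le\infty$. A set is $S$-definable if it belongs to some $S^p$. A map $f:X\to Y$ between $S$-definable sets is $S$-definable if its graph $\{(x,y)\in X\times Y: y=f(x)\}$ is $S$-definable. A map is definable in a tame structure if it is $S$-definable for some tame structure $S$. *)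

(* Defs.v *)
From mathcomp Require Import all_boot all_order all_algebra.
From mathcomp Require Import mpoly.
From mathcomp Require Import classical_sets reals constructive_ereal.

Set Implicit Arguments.
Unset Strict Implicit.
Unset Printing Implicit Defensive.

Import Order.TTheory GRing.Theory Num.Theory.

Local Open Scope ring_scope.
Local Open Scope classical_set_scope.

Definition evalr (R : realType) (n : nat) (f : {mpoly R[n]}) (x : 'rV[R]_n) : R :=
  f.@[fun i => x 0 i].

(* R^p * R^q is identified with R^(p + q): the pair (x, y) is row_mx x y, whose
   components are recovered by lsubmx and rsubmx. *)
Definition prodset (R : realType) (p q : nat)
    (X : set 'rV[R]_p) (Y : set 'rV[R]_q) : set 'rV[R]_(p + q) :=
  [set z | X (lsubmx z) /\ Y (rsubmx z)].

(* Only the components S p with 0 < p are meaningful; S 0 is left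
   unconstrained and is never used. *)
Record R_structure (R : realType) (S : forall p : nat, set (set 'rV[R]_p)) :
    Prop := {
  structure_zeros : forall (p : nat) (s : seq {mpoly R[p]}), (0 < p)%N ->
    S p [set x | forall f, f \in s -> evalr f x = 0];
  structure_halfspace : forall (p : nat) (L : {linear 'rV[R]_p -> R^o}),
    (0 < p)%N -> S p [set x | (0 : R) <= L x];
  structure_setU : forall (p : nat) (X Y : set 'rV[R]_p), (0 < p)%N ->
    S p X -> S p Y -> S p (X `|` Y);
  structure_setI : forall (p : nat) (X Y : set 'rV[R]_p), (0 < p)%N ->
    S p X -> S p Y -> S p (X `&` Y);
  structure_setC : forall (p : nat) (X : set 'rV[R]_p), (0 < p)%N ->
    S p X -> S p (~` X);
  structure_prod : forall (p q : nat) (X : set 'rV[R]_p) (Y : set 'rV[R]_q),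
    (0 < p)%N -> (0 < q)%N -> S p X -> S q Y -> S (p + q)%N (prodset X Y);
  structure_affine : forall (p q : nat) (A : {linear 'rV[R]_p -> 'rV[R]_q})
      (c : 'rV[R]_q) (X : set 'rV[R]_p),
    (0 < p)%N -> (0 < q)%N -> S p X -> S q [set A x + c | x in X]
}.

Definition finite_union_of_points_and_intervals (R : realType)
    (X : set 'rV[R]_1) : Prop :=
  exists (s : seq R) (t : seq (\bar R * \bar R)),
    (forall ab, ab \in t -> (ab.1 < ab.2)%E) /\
    X = [set x | x 0 0 \in s \/
                 exists2 ab, ab \in t & (ab.1 < (x 0 0)%:E < ab.2)%E].

Definition tame_structure (R : realType)
    (S : forall p : nat, set (set 'rV[R]_p)) : Prop :=
  R_structure S /\
  forall X : set 'rV[R]_1, S 1%N X -> finite_union_of_points_and_intervals X.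

(* A map X -> Y is represented by a total function f sending X into Y; only
   the values of f on X matter. *)
Definition definable_map (R : realType)
    (S : forall p : nat, set (set 'rV[R]_p)) (p q : nat)
    (X : set 'rV[R]_p) (Y : set 'rV[R]_q) (f : 'rV[R]_p -> 'rV[R]_q) : Prop :=
  [/\ S p X, S q Y, (forall x, X x -> Y (f x))
    & S (p + q)%N
        (prodset X Y `&` [set z | rsubmx z = f (lsubmx z)])].

Definition definable_in_tame_structure (R : realType) (p q : nat)
    (X : set 'rV[R]_p) (Y : set 'rV[R]_q) (f : 'rV[R]_p -> 'rV[R]_q) : Prop :=
  exists S : forall p : nat, set (set 'rV[R]_p),
    tame_structure S /\ definable_map S X Y f.

(* The product is indexed by j = 1, ..., m; the other values of q are unused. *)
Definition Ltilde (R : realType) (k l m : nat) (b : {mpoly R[l]})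
    (q : nat -> {mpoly R[k + l]}) (lambda : R)
    (x : 'rV[R]_k) (y : 'rV[R]_l) : R :=
  evalr b y - lambda * \prod_(1 <= j < m.+1) evalr (q j) (row_mx x y).

(* Main.v *)
Require Import Defs.
From mathcomp Require Import all_boot all_order all_algebra.
From mathcomp Require Import mpoly.
From mathcomp Require Import boolp classical_sets reals constructive_ereal.
From mathcomp Require Import polyrcf.
From mathcomp Require ordered_qelim qe_rcf.

Set Implicit Arguments.
Unset Strict Implicit.
Unset Printing Implicit Defensive.

Import Order.TTheory GRing.Theory Num.Theory.

Local Open Scope ring_scope.
Local Open Scope classical_set_scope.

(** The function is a polynomial in (x, y): b is a polynomial, and a finite
product of polynomials is one. Its graph is therefore the zero set of a
polynomial, and it only remains to exhibit one tame structure; the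
semialgebraic sets form it.

A semialgebraic subset of R^n is taken here to be the truth set of a
quantifier-free formula in the language of ordered rings with constants in R,
that is, a Boolean combination of polynomial equations and inequalities. All
the closure properties of an R-structure except the one under affine images
are then syntactic: Boolean operations are connectives, and products reduce to
preimages under the two block projections, because substituting polynomials
for the variables of a polynomial yields a polynomial
([semialgebraic_preimage]). The closure under images by an affine map F is the
Tarski-Seidenberg theorem: F(X) is the projection to the first block of the semialgebraic set of the
pairs (F(x), x) with x in X, and a projection is a block of existential
quantifiers, which quantifier elimination over real closed fields removes one
variable at a time ([semialgebraic_proj], [semialgebraic_image]).

Tameness holds because a polynomial in one variable has finitely many roots
and, by the intermediate value theorem, a constant sign between them. So
membership in a semialgebraic subset of the line can change only at finitely
many breakpoints ([qf_eval_locally_constant]), and a subset of the line with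
that property is a finite union of points and open intervals
([locally_constant_off_finite_union]). *)

(** * Polynomial functions *)

Section PolynomialFunctions.
Variable R : realType.

Definition coords (n : nat) (x : 'rV[R]_n) : seq R :=
  [seq x 0 i | i <- enum 'I_n].

Lemma size_coords n (x : 'rV[R]_n) : size (coords x) = n.
Proof. by rewrite size_map size_enum_ord. Qed.

Lemma nth_coords n (x : 'rV[R]_n) (i : 'I_n) : (coords x)`_i = x 0 i.
Proof. by rewrite (nth_map i) ?size_enum_ord // nth_ord_enum. Qed.

Lemma coords_row_mx p q (x : 'rV[R]_p) (y : 'rV[R]_q) :
  coords (row_mx x y) = coords x ++ coords y.
Proof.
apply: (@eq_from_nth _ 0) => [|i]; rewrite ?size_cat !size_coords // => ltipq.
rewrite -[i]/(val (Ordinal ltipq)) nth_cat size_coords.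
case: (split_ordP (Ordinal ltipq)) => j ->; rewrite nth_coords.
  by rewrite row_mxEl /= nth_coords.
by rewrite row_mxEr /= addKn nth_coords.
Qed.

Lemma coords_row_of (p : nat) (e : seq R) :
  size e = p -> coords (\row_(i < p) e`_i) = e.
Proof.
move=> sz_e; apply: (@eq_from_nth _ 0) => [|i]; rewrite size_coords // => ltip.
by rewrite (nth_coords _ (Ordinal ltip)) mxE.
Qed.

(** Polynomials are given by terms rather than by elements of {mpoly R[n]},
since formulas are built from terms: atoms of a formula and polynomial
functions then correspond without translation. *)
Definition polynomial_fun (n : nat) (g : 'rV[R]_n -> R) : Prop :=
  exists t : qe_rcf.term R, forall x, g x = qe_rcf.eval (coords x) t.

Lemma polynomial_fun_coord n (i : 'I_n) : polynomial_fun (fun x => x 0 i).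
Proof. by exists (qe_rcf.Var R i) => x /=; rewrite nth_coords. Qed.

Lemma polynomial_fun_cst n (c : R) : polynomial_fun (fun _ : 'rV[R]_n => c).
Proof. by exists (qe_rcf.Const c). Qed.

Lemma polynomial_funD n (g h : 'rV[R]_n -> R) :
  polynomial_fun g -> polynomial_fun h -> polynomial_fun (fun x => g x + h x).
Proof.
by move=> [t tE] [u uE]; exists (qe_rcf.Add t u) => x /=; rewrite tE uE.
Qed.

Lemma polynomial_funN n (g : 'rV[R]_n -> R) :
  polynomial_fun g -> polynomial_fun (fun x => - g x).
Proof. by move=> [t tE]; exists (qe_rcf.Opp t) => x /=; rewrite tE. Qed.

Lemma polynomial_funM n (g h : 'rV[R]_n -> R) :
  polynomial_fun g -> polynomial_fun h -> polynomial_fun (fun x => g x * h x).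
Proof.
by move=> [t tE] [u uE]; exists (qe_rcf.Mul t u) => x /=; rewrite tE uE.
Qed.

Lemma polynomial_funX n (g : 'rV[R]_n -> R) k :
  polynomial_fun g -> polynomial_fun (fun x => g x ^+ k).
Proof. by move=> [t tE]; exists (qe_rcf.Exp t k) => x /=; rewrite tE. Qed.

Lemma polynomial_fun_sum n I (r : seq I) (g : I -> 'rV[R]_n -> R) :
  (forall i, polynomial_fun (g i)) ->
  polynomial_fun (fun x => \sum_(i <- r) g i x).
Proof.
move=> pg; elim: r => [|i r IHr].
  under eq_fun do rewrite big_nil; exact: polynomial_fun_cst.
under eq_fun do rewrite big_cons; exact: polynomial_funD.
Qed.

Lemma polynomial_fun_prod n I (r : seq I) (g : I -> 'rV[R]_n -> R) :
  (forall i, polynomial_fun (g i)) ->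
  polynomial_fun (fun x => \prod_(i <- r) g i x).
Proof.
move=> pg; elim: r => [|i r IHr].
  under eq_fun do rewrite big_nil; exact: polynomial_fun_cst.
under eq_fun do rewrite big_cons; exact: polynomial_funM.
Qed.

Lemma polynomial_fun_linear n (L : {linear 'rV[R]_n -> R^o}) :
  polynomial_fun (L : 'rV[R]_n -> R).
Proof.
have -> : (L : 'rV[R]_n -> R) =
    (fun x => \sum_(i <- enum 'I_n) x 0 i * L (delta_mx 0 i)).
  apply: funext => x; rewrite [in LHS](row_sum_delta x) linear_sum big_enum /=.
  by apply: eq_bigr => i _; rewrite linearZ.
apply: polynomial_fun_sum => i; apply: polynomial_funM.
  exact: polynomial_fun_coord.
exact: polynomial_fun_cst.
Qed.

Definition polynomial_map (p n : nat) (F : 'rV[R]_n -> 'rV[R]_p) : Prop :=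
  forall i, polynomial_fun (fun x => F x 0 i).

Lemma polynomial_map_linear p n (A : {linear 'rV[R]_n -> 'rV[R]_p}) :
  polynomial_map A.
Proof.
move=> i.
have -> : (fun x => A x 0 i) =
    (fun x => \sum_(j <- enum 'I_n) x 0 j * A (delta_mx 0 j) 0 i).
  apply: funext => x; rewrite [in LHS](row_sum_delta x) linear_sum big_enum /=.
  by rewrite summxE; apply: eq_bigr => j _; rewrite linearZ mxE.
apply: polynomial_fun_sum => j; apply: polynomial_funM.
  exact: polynomial_fun_coord.
exact: polynomial_fun_cst.
Qed.

Lemma polynomial_map_lsubmx p q :
  polynomial_map (lsubmx : 'rV[R]_(p + q) -> 'rV[R]_p).
Proof. exact: polynomial_map_linear. Qed.

Lemma polynomial_map_rsubmx p q :
  polynomial_map (rsubmx : 'rV[R]_(p + q) -> 'rV[R]_q).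
Proof. exact: polynomial_map_linear. Qed.

(** This is the substitution of polynomials for the variables of a term. The
variables of t beyond the p-th read the default value 0, so that no bound on
the variables of t has to be assumed. *)
Lemma polynomial_fun_eval p n (F : 'rV[R]_n -> 'rV[R]_p) t :
  polynomial_map F -> polynomial_fun (fun x => qe_rcf.eval (coords (F x)) t).
Proof.
move=> pF; elim: t => [i|c|k|t IHt u IHu|t IHt|t IHt k|t IHt u IHu|t IHt k] /=.
- have [ltip|leip] := ltnP i p.
    under eq_fun do rewrite (nth_coords _ (Ordinal ltip)); exact: pF.
  under eq_fun do rewrite nth_default ?size_coords//.
  exact: polynomial_fun_cst.
- exact: polynomial_fun_cst.
- exact: polynomial_fun_cst.
- exact: polynomial_funD.
- exact: polynomial_funN.
- under eq_fun do rewrite -mulr_natr.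
  by apply: polynomial_funM => //; exact: polynomial_fun_cst.
- exact: polynomial_funM.
- exact: polynomial_funX.
Qed.

Lemma polynomial_fun_comp p n (F : 'rV[R]_n -> 'rV[R]_p) g :
  polynomial_fun g -> polynomial_map F -> polynomial_fun (fun x => g (F x)).
Proof.
move=> [t tE] pF; under eq_fun do rewrite tE; exact: polynomial_fun_eval.
Qed.

Lemma polynomial_fun_evalr n (f : {mpoly R[n]}) : polynomial_fun (evalr f).
Proof.
have -> : evalr f = fun x => \sum_(m <- msupp f)
    f@_m * \prod_(i <- enum 'I_n) x 0 i ^+ m i.
  apply: funext => x; rewrite /evalr mevalE.
  by apply: eq_bigr => m _; rewrite big_enum.
apply: polynomial_fun_sum => m; apply: polynomial_funM.
  exact: polynomial_fun_cst.
apply: polynomial_fun_prod => i; apply: polynomial_funX.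
exact: polynomial_fun_coord.
Qed.

End PolynomialFunctions.

(** * Semialgebraic sets *)

Section SemialgebraicSets.
Variable R : realType.

Definition semialgebraic (n : nat) : set (set 'rV[R]_n) :=
  [set X | exists f : qe_rcf.formula R,
             X = [set x | qe_rcf.qf_eval (coords x) f]].

Lemma semialgebraic_setC n (X : set 'rV[R]_n) :
  semialgebraic X -> semialgebraic (~` X).
Proof.
move=> [f ->]; exists (qe_rcf.Not f); apply/seteqP.
by split=> x /= /negP.
Qed.

Lemma semialgebraic_setI n (X Y : set 'rV[R]_n) :
  semialgebraic X -> semialgebraic Y -> semialgebraic (X `&` Y).
Proof.
move=> [f ->] [g ->]; exists (qe_rcf.And f g); apply/seteqP.
by split=> x /= /andP.
Qed.

Lemma semialgebraic_setU n (X Y : set 'rV[R]_n) :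
  semialgebraic X -> semialgebraic Y -> semialgebraic (X `|` Y).
Proof.
move=> [f ->] [g ->]; exists (qe_rcf.Or f g); apply/seteqP.
by split=> x /= /orP.
Qed.

Lemma semialgebraic_bool n (b : bool) : semialgebraic [set _ : 'rV[R]_n | b].
Proof. by exists (qe_rcf.Bool b). Qed.

Lemma semialgebraic_setT n : semialgebraic [set: 'rV[R]_n].
Proof. by exists (qe_rcf.Bool true); apply/seteqP; split. Qed.

Lemma semialgebraic_eq n (g h : 'rV[R]_n -> R) :
  polynomial_fun g -> polynomial_fun h -> semialgebraic [set x | g x = h x].
Proof.
move=> [t tE] [u uE]; exists (qe_rcf.Equal t u); apply/seteqP.
by split=> x /=; rewrite tE uE => /eqP.
Qed.

Lemma semialgebraic_lt n (g h : 'rV[R]_n -> R) :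
  polynomial_fun g -> polynomial_fun h -> semialgebraic [set x | g x < h x].
Proof.
move=> [t tE] [u uE]; exists (qe_rcf.Lt t u); apply/seteqP.
by split=> x /=; rewrite tE uE.
Qed.

Lemma semialgebraic_le n (g h : 'rV[R]_n -> R) :
  polynomial_fun g -> polynomial_fun h -> semialgebraic [set x | g x <= h x].
Proof.
move=> [t tE] [u uE]; exists (qe_rcf.Le t u); apply/seteqP.
by split=> x /=; rewrite tE uE.
Qed.

Lemma semialgebraic_forall_in n (T : eqType) (s : seq T)
    (X : T -> set 'rV[R]_n) :
  (forall i, semialgebraic (X i)) ->
  semialgebraic [set x | forall i, i \in s -> X i x].
Proof.
move=> sX; elim: s => [|i s IHs].
  rewrite (_ : mkset _ = setT); first exact: semialgebraic_setT.
  by apply/seteqP; split.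
rewrite (_ : mkset _ = X i `&` [set x | forall j, j \in s -> X j x]).
  exact: semialgebraic_setI.
apply/seteqP; split=> x /=.
  by move=> Xx; split=> [|j js]; apply: Xx; rewrite inE ?eqxx ?js ?orbT.
by move=> [Xi Xs] j; rewrite inE => /predU1P[->|/Xs].
Qed.

(** By induction on the formula, since its atoms compare terms, and terms
compose with polynomial maps. *)
Lemma semialgebraic_preimage p n (F : 'rV[R]_n -> 'rV[R]_p) X :
  polynomial_map F -> semialgebraic X -> semialgebraic [set x | X (F x)].
Proof.
move=> pF [f ->] /=; elim: f => /= [b|t u|t u|t u|f IHf g IHg|f IHf g IHg
                                  |f IHf g IHg|f IHf].
- exact: semialgebraic_bool.
- rewrite (_ : mkset _ = [set x | qe_rcf.eval (coords (F x)) t =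
                                  qe_rcf.eval (coords (F x)) u]).
    by apply: semialgebraic_eq; exact: polynomial_fun_eval.
  by apply/seteqP; split=> x /= /eqP.
- by apply: semialgebraic_lt; exact: polynomial_fun_eval.
- by apply: semialgebraic_le; exact: polynomial_fun_eval.
- have := semialgebraic_setI IHf IHg; congr semialgebraic.
  by apply/seteqP; split=> x /= /andP.
- have := semialgebraic_setU IHf IHg; congr semialgebraic.
  by apply/seteqP; split=> x /= /orP.
- have := semialgebraic_setU (semialgebraic_setC IHf) IHg; congr semialgebraic.
  apply/seteqP; split=> x /=; rewrite implybE.
    by move=> [/negP->|->]; rewrite ?orbT.
  by move=> /orP[/negP|]; [left|right].
- have := semialgebraic_setC IHf; congr semialgebraic.
  by apply/seteqP; split=> x /= /negP.
Qed.

Lemma semialgebraic_prodset p q (X : set 'rV[R]_p) (Y : set 'rV[R]_q) :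
  semialgebraic X -> semialgebraic Y -> semialgebraic (prodset X Y).
Proof.
move=> sX sY; apply: semialgebraic_setI.
  exact: semialgebraic_preimage (@polynomial_map_lsubmx R p q) sX.
exact: semialgebraic_preimage (@polynomial_map_rsubmx R p q) sY.
Qed.

End SemialgebraicSets.

(** * Projections of semialgebraic sets *)

Section Projection.
Variable R : realType.

(** Quantifier elimination returns a formula of the syntax with quantifiers and
inverses, together with the guarantee that it contains neither; this brings the
result back to the syntax in which semialgebraic sets are described. *)
Lemma qf_formula_of_ord (f : ordered_qelim.ord.formula R) :
  ordered_qelim.ord.qf_form f && ordered_qelim.ord.rformula f ->
  exists g : qe_rcf.formula R,
    forall e, qe_rcf.qf_eval e g = ordered_qelim.ord.qf_eval e f.
Proof.
have term_of t : GRing.rterm t ->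
    forall e, qe_rcf.eval e (qe_rcf.to_rterm t) = GRing.eval e t.
  by move=> rt e; rewrite qe_rcf.evalE qe_rcf.to_rtermE.
elim: f => //= [b|t u|t u|t u|f IHf g IHg|f IHf g IHg|f IHf g IHg|f IHf].
- by move=> _; exists (qe_rcf.Bool b).
- case/andP=> /term_of tE /term_of uE.
  by exists (qe_rcf.Equal (qe_rcf.to_rterm t) (qe_rcf.to_rterm u)) => e /=;
    rewrite tE uE.
- case/andP=> /term_of tE /term_of uE.
  by exists (qe_rcf.Lt (qe_rcf.to_rterm t) (qe_rcf.to_rterm u)) => e /=;
    rewrite tE uE.
- case/andP=> /term_of tE /term_of uE.
  by exists (qe_rcf.Le (qe_rcf.to_rterm t) (qe_rcf.to_rterm u)) => e /=;
    rewrite tE uE.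
- rewrite andbACA => /andP[/IHf[f' f'E] /IHg[g' g'E]].
  by exists (qe_rcf.And f' g') => e /=; rewrite f'E g'E.
- rewrite andbACA => /andP[/IHf[f' f'E] /IHg[g' g'E]].
  by exists (qe_rcf.Or f' g') => e /=; rewrite f'E g'E.
- rewrite andbACA => /andP[/IHf[f' f'E] /IHg[g' g'E]].
  by exists (qe_rcf.Implies f' g') => e /=; rewrite f'E g'E.
- move=> /IHf[f' f'E].
  by exists (qe_rcf.Not f') => e /=; rewrite f'E.
Qed.

Lemma eliminate_exists (f : qe_rcf.formula R) (i : nat) :
  exists g : qe_rcf.formula R, forall e,
    qe_rcf.qf_eval e g <-> exists x, qe_rcf.qf_eval (set_nth 0 e i x) f.
Proof.
pose h := ordered_qelim.ord.Exists i (qe_rcf.qfr_to_formula f).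
have rh : ordered_qelim.ord.rformula h by exact: qe_rcf.rformulaF.
have wf := @qe_rcf.wf_QE_wproj R.
have [g gE] := qf_formula_of_ord (ordered_qelim.ord.quantifier_elim_wf wf rh).
exists g => e; rewrite gE.
have hP := ordered_qelim.ord.quantifier_elim_rformP wf
  (@qe_rcf.valid_QE_wproj R) e rh.
rewrite -(rwP hP) /=; split=> -[x fx]; exists x; move: fx;
  by rewrite qe_rcf.qf_evalE
    (rwP (ordered_qelim.ord.qf_evalP _ (qe_rcf.qf_formF f))).
Qed.

(** Induction on the length of the block. The variables e are followed by the
quantified ones: the innermost p quantifiers are eliminated over the q + 1
free variables (e, x), and then the quantifier on x, whose index is q. *)
Lemma eliminate_exists_block (f : qe_rcf.formula R) (p q : nat) :
  exists g : qe_rcf.formula R, forall e, size e = q ->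
    qe_rcf.qf_eval e g <->
    exists2 w, size w = p & qe_rcf.qf_eval (e ++ w) f.
Proof.
elim: p q => [|p IHp] q.
  exists f => e _; split=> [fe|[w /size0nil->]]; last by rewrite cats0.
  by exists [::]; rewrite ?cats0.
have [h hE] := IHp q.+1.
have [g gE] := eliminate_exists h q.
exists g => e sz_e; rewrite gE.
(* Assigning the variable of index [size e] appends a value to e. *)
have rconsE x : set_nth 0 e q x = rcons e x.
  by rewrite -sz_e; elim: (e) => //= a s ->.
split=> [[x]|[[|x w] // [sz_w] fw]].
  rewrite rconsE hE ?size_rcons ?sz_e // => -[w sz_w].
  by rewrite cat_rcons; exists (x :: w) => //=; rewrite sz_w.
exists x; rewrite rconsE hE ?size_rcons ?sz_e //; exists w => //.
by rewrite cat_rcons.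
Qed.

(** The Tarski-Seidenberg theorem, in its geometric form. *)
Lemma semialgebraic_proj p q (Z : set 'rV[R]_(q + p)) :
  semialgebraic Z -> semialgebraic [set y | exists x, Z (row_mx y x)].
Proof.
move=> [f ->]; have [g gE] := eliminate_exists_block f p q.
exists g; apply/seteqP; split=> y /=.
  move=> [x fx]; apply/gE; rewrite ?size_coords //.
  by exists (coords x); rewrite ?size_coords // -coords_row_mx.
move/gE; rewrite size_coords => /(_ erefl)[w sz_w fw].
by exists (\row_i w`_i); rewrite coords_row_mx coords_row_of.
Qed.

(** The image is the projection of the flipped graph of F over X, the set of the
pairs (F(x), x). *)
Lemma semialgebraic_image p q (F : 'rV[R]_p -> 'rV[R]_q) X :
  polynomial_map F -> semialgebraic X -> semialgebraic [set F x | x in X].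
Proof.
move=> pF sX.
pose G := [set z : 'rV[R]_(q + p) | forall i, i \in enum 'I_q ->
  lsubmx z 0 i = F (rsubmx z) 0 i].
have sG : semialgebraic G.
  apply: semialgebraic_forall_in => i; apply: semialgebraic_eq.
    exact: polynomial_map_lsubmx.
  by apply: polynomial_fun_comp (pF i) _; exact: polynomial_map_rsubmx.
have sXG := semialgebraic_setI
  (semialgebraic_preimage (@polynomial_map_rsubmx R q p) sX) sG.
have := semialgebraic_proj sXG; congr semialgebraic.
apply/seteqP; split=> y /=.
  move=> [x []]; rewrite /G /= row_mxKr row_mxKl => Xx yE; exists x => //.
  by apply/rowP => i; rewrite yE // mem_enum.
by move=> [x Xx <-]; exists x; rewrite /G /= row_mxKr row_mxKl.
Qed.

End Projection.

(** * The tame structure of semialgebraic sets *)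

Lemma semialgebraic_R_structure (R : realType) :
  R_structure (@semialgebraic R).
Proof.
split.
- move=> p s _; apply: semialgebraic_forall_in => f; apply: semialgebraic_eq.
    exact: polynomial_fun_evalr.
  exact: polynomial_fun_cst.
- move=> p L _; apply: semialgebraic_le; first exact: polynomial_fun_cst.
  exact: polynomial_fun_linear.
- by move=> p X Y _; exact: semialgebraic_setU.
- by move=> p X Y _; exact: semialgebraic_setI.
- by move=> p X _; exact: semialgebraic_setC.
- by move=> p q X Y _ _; exact: semialgebraic_prodset.
- move=> p q A c X _ _; apply: semialgebraic_image => i.
  under eq_fun do rewrite mxE; apply: polynomial_funD.
    exact: polynomial_map_linear.
  exact: polynomial_fun_cst.
Qed.

Section Tameness.
Variable R : realType.

(** Connectedness is phrased through the two endpoints of a segment that avoids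
s; the property is then inherited by Boolean combinations, by concatenating
the lists of breakpoints. *)
Definition locally_constant_off (s : seq R) (X : set R) : Prop :=
  forall a b, a <= b -> (forall c, a <= c <= b -> c \notin s) ->
    (X a <-> X b).

Lemma horner_sg_locally_constant (p : {poly R}) :
  exists s : seq R, forall a b, a <= b ->
    (forall c, a <= c <= b -> c \notin s) -> Num.sg p.[a] = Num.sg p.[b].
Proof.
have [->|p_neq0] := eqVneq p 0.
  by exists [::] => a b _ _; rewrite !horner0.
exists (rootsR p) => a b leab s_off.
have rootF : {in `[a, b]%R, forall c, ~~ root p c}.
  move=> c; rewrite in_itv => /s_off.
  by rewrite -(roots_on_rootsR p_neq0) in_itv.
by apply: (polyrN0_itv rootF); rewrite in_itv /= lexx leab.
Qed.

Lemma eval_singleton_poly (t : qe_rcf.term R) :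
  exists p : {poly R}, forall x, qe_rcf.eval [:: x] t = p.[x].
Proof.
exists (qe_rcf.eval_poly [::] (qe_rcf.abstrX 0 t)) => x.
by rewrite qe_rcf.abstrXP.
Qed.

Lemma qf_eval_locally_constant (f : qe_rcf.formula R) :
  exists s, locally_constant_off s [set x | qe_rcf.qf_eval [:: x] f].
Proof.
(* Each atom is a condition on the sign of the difference of its two terms. *)
have sgB (t u : qe_rcf.term R) : exists s : seq R, forall a b, a <= b ->
    (forall c, a <= c <= b -> c \notin s) ->
    Num.sg (qe_rcf.eval [:: a] t - qe_rcf.eval [:: a] u) =
    Num.sg (qe_rcf.eval [:: b] t - qe_rcf.eval [:: b] u).
  have [p pE] := eval_singleton_poly t; have [q qE] := eval_singleton_poly u.
  have [s sP] := horner_sg_locally_constant (p - q).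
  exists s => a b leab /(sP _ _ leab); rewrite !hornerE => h.
  by rewrite !pE !qE.
have off_cat (s1 s2 : seq R) a b :
    (forall c, a <= c <= b -> c \notin s1 ++ s2) ->
    (forall c, a <= c <= b -> c \notin s1) /\
    (forall c, a <= c <= b -> c \notin s2).
  by move=> h; split=> c /h; rewrite mem_cat negb_or => /andP[].
elim: f => /= [c|t u|t u|t u|f [s sP] g [s' s'P]|f [s sP] g [s' s'P]
              |f [s sP] g [s' s'P]|f [s sP]].
- by exists [::].
- have [s sP] := sgB t u; exists s => a b leab /(sP _ _ leab) sgE /=.
  by rewrite -subr_eq0 -sgr_eq0 sgE sgr_eq0 subr_eq0.
- have [s sP] := sgB t u; exists s => a b leab /(sP _ _ leab) sgE /=.
  by rewrite -subr_lt0 -sgr_lt0 sgE sgr_lt0 subr_lt0.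
- have [s sP] := sgB t u; exists s => a b leab /(sP _ _ leab) sgE /=.
  by rewrite -subr_le0 -sgr_le0 sgE sgr_le0 subr_le0.
- exists (s ++ s') => a b leab /off_cat[/(sP _ _ leab) /= fE].
  move=> /(s'P _ _ leab) /= gE.
  by split=> /andP[/fE ? /gE ?]; apply/andP.
- exists (s ++ s') => a b leab /off_cat[/(sP _ _ leab) /= fE].
  move=> /(s'P _ _ leab) /= gE.
  by split=> /orP[/fE|/gE] h; apply/orP; [left|right|left|right].
- exists (s ++ s') => a b leab /off_cat[/(sP _ _ leab) /= fE].
  move=> /(s'P _ _ leab) /= gE.
  by split=> /implyP h; apply/implyP => /fE/h/gE.
- exists s => a b leab /(sP _ _ leab) /= fE.
  by split=> /negP h; apply/negP => /fE.
Qed.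

(** Induction on the breakpoints: one that lies in the interval ]a, b[ cuts it
into two intervals with fewer breakpoints, and the others are discarded. Working
in ]a, b[ instead of the whole line is what lets the induction hypothesis apply
to both pieces, and makes sorting the breakpoints superfluous. Without
breakpoints, X contains all or nothing of ]a, b[. *)
Lemma locally_constant_off_finite_union (s : seq R) (X : set R) (a b : \bar R) :
  (a < b)%E ->
  (forall u v, (a < u%:E)%E -> (v%:E < b)%E -> u <= v ->
     (forall c, u <= c <= v -> c \notin s) -> (X u <-> X v)) ->
  exists (s' : seq R) (t : seq (\bar R * \bar R)),
    (forall ab, ab \in t -> (ab.1 < ab.2)%E) /\
    forall x, (a < x%:E < b)%E /\ X x <->
      x \in s' \/ exists2 ab, ab \in t & (ab.1 < x%:E < ab.2)%E.
Proof.
elim: s a b => [|c s IHs] a b ltab Xconst.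
  have [[u /andP[ltau ltub] Xu]|noX] :=
      EM (exists2 u, (a < u%:E < b)%E & X u).
    exists [::], [:: (a, b)]; split=> [ab|x].
      by rewrite inE => /eqP->.
    split=> [[xab _]|]; first by right; exists (a, b); rewrite ?inE.
    case=> // -[ab]; rewrite inE => /eqP-> /= /andP[ltax ltxb].
    rewrite ltax ltxb; split=> //.
    by have [leux|/ltW lexu] := leP u x;
      [rewrite -(Xconst u x) | rewrite (Xconst x u)].
  exists [::], [::]; split=> // x; split=> [[xab Xx]|[|[]]//].
  by case: noX; exists x.
have [/andP[ltac ltcb]|cNab] := boolP (a < c%:E < b)%E; last first.
  apply: IHs => // u v ltau ltvb leuv uv_off; apply: Xconst => // d duv.
  rewrite inE negb_or uv_off // andbT; apply: contraNneq cNab => <-.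
  move: duv => /andP[leud ledv].
  by rewrite (lt_le_trans ltau) ?lee_fin // (le_lt_trans _ ltvb) ?lee_fin.
have [|s1 [t1 [t1P X1E]]] := IHs a c%:E ltac.
  move=> u v ltau ltvc leuv uv_off; apply: Xconst => //.
    exact: lt_trans ltcb.
  move=> d duv; rewrite inE negb_or uv_off // andbT.
  move: duv ltvc; rewrite lte_fin => /andP[_ ledv] ltvc.
  by rewrite lt_eqF // (le_lt_trans ledv).
have [|s2 [t2 [t2P X2E]]] := IHs c%:E b ltcb.
  move=> u v ltcu ltvb leuv uv_off; apply: Xconst => //.
    exact: lt_trans ltcu.
  move=> d duv; rewrite inE negb_or uv_off // andbT.
  move: duv ltcu; rewrite lte_fin => /andP[leud _] ltcu.
  by rewrite gt_eqF // (lt_le_trans ltcu).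
exists ((if `[< X c >] then [:: c] else [::]) ++ s1 ++ s2), (t1 ++ t2).
split=> [ab|x]; first by rewrite mem_cat => /orP[/t1P|/t2P].
have -> : (a < x%:E < b)%E /\ X x <->
    (x = c /\ X c) \/ ((a < x%:E < c%:E)%E /\ X x) \/
    ((c%:E < x%:E < b)%E /\ X x).
  split=> [[/andP[ltax ltxb] Xx]|].
    have [ltxc|ltcx|xc] := ltgtP x c.
    - by right; left; rewrite ltax lte_fin ltxc.
    - by right; right; rewrite ltxb lte_fin ltcx.
    - by left; rewrite -xc.
  case=> [[-> Xc]|[[/andP[ltax ltxc] Xx]|[/andP[ltcx ltxb] Xx]]].
  - by rewrite ltac ltcb.
  - by rewrite ltax (lt_trans ltxc).
  - by rewrite ltxb andbT (lt_trans _ ltcx).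
rewrite X1E X2E.
have -> : (x = c /\ X c) <-> x \in (if `[< X c >] then [:: c] else [::]).
  case: asboolP => Xc; last by split=> // -[].
  by rewrite inE; split=> [[-> _]|/eqP].
rewrite !mem_cat; split.
  case=> [->|[[->|[ab ab1 xab]]|[->|[ab ab2 xab]]]]; rewrite ?orbT; try by left.
    by right; exists ab; rewrite // mem_cat ab1.
  by right; exists ab; rewrite // mem_cat ab2 orbT.
case=> [/or3P[|xs1|xs2]|[ab]]; first by left.
- by right; left; left.
- by right; right; left.
- rewrite mem_cat => /orP[ab1|ab2] xab; right; [left|right]; right;
  by exists ab.
Qed.

Lemma semialgebraic_tame : tame_structure (@semialgebraic R).
Proof.
split=> [|X [f ->]]; first exact: semialgebraic_R_structure.
have [s sP] := qf_eval_locally_constant f.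
have [|s' [t [tP XE]]] := @locally_constant_off_finite_union s
    [set x | qe_rcf.qf_eval [:: x] f] -oo%E +oo%E isT.
  by move=> u v _ _; exact: sP.
have coords1 (x : 'rV[R]_1) : coords x = [:: x 0 0].
  by rewrite /coords enum_ordSl enum_ord0.
exists s', t; split=> //; apply/seteqP; split=> x /=.
  by rewrite coords1 => fx; apply/XE; rewrite ltNyr ltry.
by move/XE => [_]; rewrite coords1.
Qed.

End Tameness.

(** The graph of g is the zero set of y - g(x). *)
Lemma polynomial_fun_definable (R : realType) (n : nat) (g : 'rV[R]_n -> R) :
  polynomial_fun g ->
  definable_in_tame_structure [set: 'rV[R]_n] [set: 'rV[R]_1]
    (fun x => (g x)%:M).
Proof.
move=> pg; exists (@semialgebraic R); split; first exact: semialgebraic_tame.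
split=> //; try exact: semialgebraic_setT.
rewrite (_ : _ `&` _ = [set z | rsubmx z 0 0 = g (lsubmx z)]).
  apply: semialgebraic_eq; first exact: polynomial_map_rsubmx.
  exact: polynomial_fun_comp pg (@polynomial_map_lsubmx R n 1).
apply/seteqP; split=> z /=; last first.
  move=> zE; split; first by split.
  by apply/rowP => i; rewrite (ord1 i) zE mxE eqxx mulr1n.
by move=> [_ ->]; rewrite mxE eqxx mulr1n.
Qed.

Theorem proposition23 (R : realType) (k l m : nat)
    (k_ge1 : (1 <= k)%N) (l_ge1 : (1 <= l)%N) (m_ge1 : (1 <= m)%N)
    (b : {mpoly R[l]}) (P : 'M[{mpoly R[k + l]}]_m) (P_sym : P^T = P)
    (q : nat -> {mpoly R[k + l]})
    (q_def : forall (x : 'rV[R]_k) (y : 'rV[R]_l) (t : R),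
      \det (t%:M - map_mx (fun f => evalr f (row_mx x y)) P) =
      t ^+ m + \sum_(1 <= j < m.+1)
                 (-1) ^+ j * evalr (q j) (row_mx x y) * t ^+ (m - j))
    (lambda : R) (lambda_gt0 : 0 < lambda) :
  definable_in_tame_structure [set: 'rV[R]_(k + l)] [set: 'rV[R]_1]
    (fun z => (Ltilde m b q lambda (lsubmx z) (rsubmx z))%:M).
Proof.
apply: polynomial_fun_definable; apply: polynomial_funD.
  exact: polynomial_fun_comp (polynomial_fun_evalr b)
    (@polynomial_map_rsubmx R k l).
apply: polynomial_funN; apply: polynomial_funM; first exact: polynomial_fun_cst.
apply: polynomial_fun_prod => j; under eq_fun do rewrite hsubmxK.
exact: polynomial_fun_evalr.
Qed.
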